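(* Let $(Y,d)$ be a nonempty proper metric space. Then there exist a proper metric space $(X,\bar d)$, a basepoint $e\in X$, and a sequence of scaling factors $\alpha=(\alpha_n)_{n\in\mathbb{N}}$ (positive real numbers tending to infinity) such that for every non-principal ultrafilter $\mu$ on $\mathbb{N}$ there is an isometry $$\mathrm{Cone}_\mu(X,e,\alpha)\cong Y .$$
   Context: A metric space is proper if all its closed balls are compact. An isometry is a surjective distance-preserving map. Ultralimits: for a non-principal ultrafilter $\mu$ on $\mathbb{N}$ and a bounded real sequence $(r_n)$, $\lim_\mu r_n$ is the unique $a\in\mathbb{R}$ such that for every neighbourhood $U$ of $a$ one has $\{n: r_n\in U\}\in\mu$. A property holds $\mu$-almost everywhere if the set of indices where it holds lies in $\mu$. Asymptotic cone: let $(X,d)$ be a metric space, $e\in X$ a basepoint, $\mu$ a non-principal ultrafilter on $\mathbb{N}$, and $\alpha=(\alpha_n)$ a sequence of positive reals tending to infinity. Consider all sequences $(x_n)$ in $X$ for which $d(x_n,e)/\alpha_n$ is bounded $\mu$-almost everywhere (i.e. there is $C>0$ with $\{n: d(x_n,e)/\alpha_n<C\}\in\mu$). On this set, $d_\infty((x_n),(y_n)):=\lim_\mu d(x_n,y_n)/\alpha_n$ is a pseudo-metric. $\mathrm{Cone}_\mu(X,e,\alpha)$ is the metric space obtained by identifying sequences at $d_\infty$-distance $0$, with the induced metric $d_\infty$. *)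

(* Defs.v *)
From HB Require Import structures.
From mathcomp Require Import all_boot all_order all_algebra.
From mathcomp Require Export generic_quotient.
From mathcomp Require Export all_classical all_reals all_analysis.

Set Implicit Arguments.
Unset Strict Implicit.
Unset Printing Implicit Defensive.

Import Order.TTheory GRing.Theory Num.Theory.
Import numFieldNormedType.Exports.
Export numFieldNormedType.Exports.

Local Open Scope classical_set_scope.
Local Open Scope ring_scope.
Local Open Scope quotient_scope.

(* The library's [closed_ball x r] is the closure of the open ball, which in a
   general metric space may be smaller than the closed ball used here. *)
Definition proper_metric (R : realType) (X : metricType R) : Prop :=
  forall (x : X) (r : R), compact [set y : X | mdist x y <= r].

Definition isometry (R : realType) (X Y : metricType R) (f : X -> Y) : Prop :=
  (forall x x' : X, mdist (f x) (f x') = mdist x x') /\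
  (forall y : Y, exists x : X, f x = y).

Definition isometric (R : realType) (X Y : metricType R) : Prop :=
  exists f : X -> Y, isometry f.

Definition nonprincipal (mu : set_system nat) : Prop :=
  forall k : nat, mu <> principal_filter k.

Section AsymptoticCone.
Context (R : realType) (X : metricType R) (e : X).
Context (alpha : nat -> R) (alpha_gt0 : forall n, 0 < alpha n).
Context (mu : set_system nat) (mu_ultra : UltraFilter mu).

Definition cone_bounded (x : nat -> X) : Prop :=
  exists2 C : R, 0 < C & \forall n \near mu, mdist (x n) e / alpha n < C.

Definition cone_dist (x y : nat -> X) : R :=
  lim (mdist (x n) (y n) / alpha n @[n --> mu]).

Definition cone_seq : Type := {x : nat -> X | cone_bounded x}.

HB.instance Definition _ := gen_eqMixin cone_seq.
HB.instance Definition _ := gen_choiceMixin cone_seq.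

Definition cone_val (x : cone_seq) : nat -> X := sval x.

Lemma cone_dist_cvg (x y : cone_seq) :
  mdist (cone_val x n) (cone_val y n) / alpha n @[n --> mu]
    --> cone_dist (cone_val x) (cone_val y).
Proof.
rewrite /cone_dist; case: x y => [x [C C0 xC]] [y [D D0 yD]] /=; rewrite /cone_val/=.
set u := fun n => mdist (x n) (y n) / alpha n.
have uCD : mu (u @^-1` `[0, C + D]).
  apply: filterS2 xC yD => n xC yD; rewrite /= in_itv/= divr_ge0 ?mdist_ge0//=.
    rewrite (@le_trans _ _ (mdist (x n) e / alpha n + mdist (y n) e / alpha n))//.
      rewrite -mulrDl ler_pM2r ?invr_gt0// [in leRHS](metric_sym (y n)).
      exact: metric_triangle.
    by rewrite lerD// ltW.
  exact: ltW.
have [l [_ ul]] : `[0, C + D] `&` cluster (u @ mu) !=set0.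
  exact: (@segment_compact R 0 (C + D) (u @ mu) _ uCD).
apply: (cvgP l) => A lA.
have [//|muA] := in_ultra_setVsetC (u @^-1` A) mu_ultra.
by have [z [nAz Az]] := ul (~` A) A muA lA.
Qed.

Arguments cone_dist_cvg : clear implicits.

Lemma cone_distxx (x : cone_seq) : cone_dist (cone_val x) (cone_val x) = 0.
Proof.
rewrite /cone_dist; under eq_fun do rewrite mdistxx mul0r.
exact: lim_cst.
Qed.

Lemma cone_dist_sym (x y : cone_seq) :
  cone_dist (cone_val x) (cone_val y) = cone_dist (cone_val y) (cone_val x).
Proof. by rewrite /cone_dist; under eq_fun do rewrite metric_sym. Qed.

Lemma cone_dist_triangle (y x z : cone_seq) :
  cone_dist (cone_val x) (cone_val z) <=
  cone_dist (cone_val x) (cone_val y) + cone_dist (cone_val y) (cone_val z).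
Proof.
have xyz := cvgD (cone_dist_cvg x y) (cone_dist_cvg y z).
apply: (ler_cvg_to (cone_dist_cvg x z) (xyz _)).
near=> n; rewrite /= -mulrDl ler_pM2r ?invr_gt0//; exact: metric_triangle.
Unshelve. all: by end_near. Qed.

Lemma cone_dist_ge0 (x y : cone_seq) :
  0 <= cone_dist (cone_val x) (cone_val y).
Proof.
apply: (cvgr_to_ge (cone_dist_cvg x y)).
by near=> n; rewrite divr_ge0 ?mdist_ge0 ?ltW.
Unshelve. all: by end_near. Qed.

Definition cone_equiv (x y : cone_seq) : bool :=
  cone_dist (cone_val x) (cone_val y) == 0.

Lemma cone_equiv_refl : reflexive cone_equiv.
Proof. by move=> x; apply/eqP; exact: cone_distxx. Qed.

Lemma cone_equiv_sym : symmetric cone_equiv.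
Proof. by move=> x y; rewrite /cone_equiv cone_dist_sym. Qed.

Lemma cone_equiv_trans : transitive cone_equiv.
Proof.
move=> y x z /eqP xy /eqP yz; rewrite /cone_equiv eq_le cone_dist_ge0 andbT.
by rewrite (le_trans (cone_dist_triangle y x z))// xy yz addr0.
Qed.

Canonical cone_equiv_rel :=
  EquivRel cone_equiv cone_equiv_refl cone_equiv_sym cone_equiv_trans.

Definition Cone : Type := {eq_quot cone_equiv_rel}.

HB.instance Definition _ := Choice.on Cone.
HB.instance Definition _ := EqQuotient.on Cone.

Definition Cone_dist (p q : Cone) : R :=
  cone_dist (cone_val (repr p)) (cone_val (repr q)).

Lemma Cone_dist_pi (x y : cone_seq) :
  Cone_dist (\pi_Cone x) (\pi_Cone y) = cone_dist (cone_val x) (cone_val y).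
Proof.
have rep z : cone_dist (cone_val z) (cone_val (repr (\pi_Cone z))) = 0.
  by apply/eqP; rewrite -[_ == _]/(cone_equiv_rel _ _) -eqmodE reprK.
have rep' z : cone_dist (cone_val (repr (\pi_Cone z))) (cone_val z) = 0.
  by rewrite cone_dist_sym.
apply/eqP; rewrite eq_le /Cone_dist; apply/andP; split.
  rewrite (le_trans (cone_dist_triangle x _ _))// rep' add0r.
  by rewrite (le_trans (cone_dist_triangle y _ _))// rep addr0.
rewrite (le_trans (cone_dist_triangle (repr (\pi_Cone x)) _ _))// rep add0r.
rewrite (le_trans (cone_dist_triangle (repr (\pi_Cone y)) _ _))//.
by rewrite rep' addr0.
Qed.

Lemma Cone_distxx (p : Cone) : Cone_dist p p = 0.
Proof. exact: cone_distxx. Qed.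

Lemma Cone_dist_positivity (p q : Cone) : Cone_dist p q = 0 -> p = q.
Proof.
move=> pq; rewrite -(reprK p) -(reprK q).
by apply/eqP; rewrite eqmodE; apply/eqP.
Qed.

Lemma Cone_dist_sym (p q : Cone) : Cone_dist p q = Cone_dist q p.
Proof. exact: cone_dist_sym. Qed.

Lemma Cone_dist_triangle (q p r : Cone) :
  Cone_dist p r <= Cone_dist p q + Cone_dist q r.
Proof. exact: cone_dist_triangle. Qed.

HB.instance Definition _ := @isMetric.Build R Cone Cone_dist
  Cone_distxx Cone_dist_positivity Cone_dist_sym Cone_dist_triangle.

Lemma Cone_mdistE (x y : cone_seq) :
  mdist (\pi_Cone x) (\pi_Cone y) =
  lim (mdist (cone_val x n) (cone_val y n) / alpha n @[n --> mu]).
Proof. exact: Cone_dist_pi. Qed.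

End AsymptoticCone.

(* Main.v *)
(* Glue at one point the annuli {1/(n+1) <= d(y, y0) <= n+1} of Y, the n-th one
   rescaled by a_n = ((n+1)!)^2. Since a_n grows fast, at scale a_n the annuli of
   index < n shrink to the base point and those of index > n are pushed to
   infinity, so only the n-th annulus is seen, and these annuli exhaust
   Y \ {y0}. The lower radii 1/(n+1) keep the annuli away from the base point,
   so that a ball meets finitely many of them and the wedge is proper. An
   ultralimit in Y, which exists by properness, identifies a point of the cone
   with a point of Y. *)
From HB Require Import structures.
Require Import Defs.
From mathcomp Require Import all_boot all_order all_algebra.

Set Implicit Arguments.
Unset Strict Implicit.
Unset Printing Implicit Defensive.

Import Order.TTheory GRing.Theory Num.Theory.
Import metricType_numDomainType.
Local Open Scope classical_set_scope.
Local Open Scope ring_scope.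
Local Open Scope quotient_scope.

(** * Ultrafilter convergence and properness *)

Lemma nonprincipal_cvg_infty (mu : set_system nat) :
  UltraFilter mu -> nonprincipal mu -> mu --> \oo.
Proof.
move=> mu_ultra mu_np.
(* An ultrafilter containing a singleton is principal. *)
have mu_neq k : mu (~` [set k]).
  have [muk|//] := in_ultra_setVsetC [set k] mu_ultra.
  case: (mu_np k); apply/predeqP => A; rewrite principal_filterP; split.
    by move=> /(filterI muk) /filter_ex[_ [->]].
  by move=> Ak; apply: filterS muk => _ ->.
have mu_ge k : mu [set n | (k <= n)%N].
  elim: k => [|k IHk]; first by apply: filterE.
  apply: filterS2 IHk (mu_neq k) => n /= kn /eqP nk.
  by rewrite ltn_neqAle eq_sym nk.
by move=> A [k _ kA]; apply: filterS (mu_ge k).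
Qed.

(** A cluster point of an ultrafilter is a limit: if one of its neighbourhoods were missing, the
    complement would belong to the ultrafilter and would have to meet that neighbourhood. *)
Lemma proper_ultra_cvg (R : realType) (Y : metricType R) (y : Y) (r : R)
    (T : Type) (F : set_system T) (f : T -> Y) :
  proper_metric Y -> UltraFilter F -> F [set t | mdist y (f t) <= r] ->
  exists l : Y, f @ F --> l.
Proof.
move=> Yproper F_ultra Fr.
have [l [_ cl]] := Yproper y r (f @ F) _ Fr.
exists l => A lA; have [//|FnA] := in_ultra_setVsetC (f @^-1` A) F_ultra.
by have [z [nAz Az]] := cl (~` A) A FnA lA.
Qed.

(** Compactness is tested on ultrafilters: every ball lies in a ball around [e], and a limit cannot
    leave a closed ball. *)
Lemma ultra_cvg_proper (R : realType) (X : metricType R) (e : X) :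
  (forall (r : R) (F : set_system X), UltraFilter F ->
    F [set x | mdist x e <= r] -> exists l : X, F --> l) ->
  proper_metric X.
Proof.
move=> Xcvg x r; rewrite compact_ultra => F F_ultra Fr.
have [|l Fl] := Xcvg (r + mdist x e) F F_ultra.
  apply: filterS Fr => z /= xz.
  by rewrite (le_trans (metric_triangle _ x _))// lerD2r metric_sym.
exists l; split => //=; apply/ler_addgt0Pl => d d0.
have [z [/= lz xz]] := filter_ex (filterI (cvgr_dist_lt Fl d0) Fr).
by rewrite (le_trans (metric_triangle _ z _))// addrC lerD// metric_sym ltW.
Qed.

(** * The scaling factors *)

Definition scale (R : realType) (n : nat) : R := (n.+1`! ^ 2)%:R.

Lemma scale_gt0 (R : realType) n : 0 < scale R n.
Proof. by rewrite ltr0n expn_gt0 fact_gt0. Qed.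

Lemma scale_ge (R : realType) n : n%:R <= scale R n.
Proof.
rewrite ler_nat; apply: leq_trans (fact_geq n) _.
by rewrite (leq_trans (leq_fact (leqnSn n)))// leq_pmulr// fact_gt0.
Qed.

(** Since (n+1)!^2 = (n+1)^2 n!^2 and (m+1)! <= n!. The two spare factors will absorb the radii of
    the annuli. *)
Lemma scale_growth (R : realType) m n : (m < n)%N ->
  scale R m * m.+1%:R * n.+1%:R <= scale R n.
Proof.
move=> mn; rewrite /scale -!natrM ler_nat [n.+1`!]factS expnMn -mulnA mulnC.
rewrite leq_mul// ?leq_exp2r ?leq_fact//.
by rewrite expnS expn1 leq_mul// ltnS ltnW.
Qed.

(** * The wedge of rescaled annuli and its properness *)

Section Wedge.
Context (R : realType) (Y : metricType R) (y0 : Y).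
Local Notation a := (scale R).

Definition annulus (n : nat) (y : Y) : Prop :=
  n.+1%:R^-1 <= mdist y y0 <= n.+1%:R.

Lemma annulus_base n : ~ annulus n y0.
Proof. by rewrite /annulus mdistxx leNgt invr_gt0 ltr0n. Qed.

(* The annuli glued at a common point, which is encoded as [(0, y0)]: no
   annulus contains [y0]. *)
Definition wedge : Type :=
  {p : nat * Y | p = (0%N, y0) \/ annulus p.1 p.2}.

HB.instance Definition _ := gen_eqMixin wedge.
HB.instance Definition _ := gen_choiceMixin wedge.

Definition wedge_base : wedge := exist _ (0%N, y0) (or_introl erefl).

Definition wedge_norm (p : wedge) : R := a (sval p).1 * mdist (sval p).2 y0.

(** Different annuli are joined through the base point. The base point carries index 0, and against
    a point of annulus 0 both branches give the norm of that point. *)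
Definition wedge_dist (p q : wedge) : R :=
  if (sval p).1 == (sval q).1 then a (sval p).1 * mdist (sval p).2 (sval q).2
  else wedge_norm p + wedge_norm q.

Lemma wedge_norm_ge0 p : 0 <= wedge_norm p.
Proof. by rewrite mulr_ge0 ?mdist_ge0// ltW// scale_gt0. Qed.

Lemma wedge_norm_eq0 p : wedge_norm p = 0 -> p = wedge_base.
Proof.
case: p => -[n y] /= py /eqP; rewrite mulf_eq0 gt_eqF ?scale_gt0//= => /eqP yy0.
apply: eq_exist; move: py; move/mdist_positivity: yy0 => ->.
by case=> // /annulus_base.
Qed.

Lemma wedge_distxx p : wedge_dist p p = 0.
Proof. by rewrite /wedge_dist eqxx mdistxx mulr0. Qed.

Lemma wedge_dist_sym p q : wedge_dist p q = wedge_dist q p.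
Proof.
by rewrite /wedge_dist eq_sym metric_sym addrC; case: eqP => [->|].
Qed.

Lemma wedge_dist_positivity p q : wedge_dist p q = 0 -> p = q.
Proof.
rewrite /wedge_dist; case: eqP => [pq|_ /eqP]; last first.
  rewrite paddr_eq0 ?wedge_norm_ge0// => /andP[/eqP p0 /eqP q0].
  by rewrite (wedge_norm_eq0 p0) (wedge_norm_eq0 q0).
move/eqP; rewrite mulf_eq0 gt_eqF ?scale_gt0//= => /eqP /mdist_positivity.
by case: p q pq => -[n y] py [[m z] qz] /= ? ?; subst; apply: eq_exist.
Qed.

Lemma wedge_dist_le_norm p q : wedge_dist p q <= wedge_norm p + wedge_norm q.
Proof.
rewrite /wedge_dist; case: eqP => // pq; rewrite /wedge_norm -pq -mulrDr.
rewrite ler_pM2l ?scale_gt0// [mdist (sval q).2 _]metric_sym.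
exact: metric_triangle.
Qed.

Lemma wedge_norm_le_dist p q : wedge_norm p <= wedge_dist p q + wedge_norm q.
Proof.
rewrite /wedge_dist; case: eqP => [pq|_]; last first.
  by rewrite -addrA lerDl addr_ge0 ?wedge_norm_ge0.
rewrite /wedge_norm -pq -mulrDr ler_pM2l ?scale_gt0//.
exact: metric_triangle.
Qed.

Lemma wedge_dist_triangle q p r :
  wedge_dist p r <= wedge_dist p q + wedge_dist q r.
Proof.
(* If the index changes between [p] and [q] or between [q] and [r], the detour passes through the
   base point and the norm bounds suffice; otherwise all three points lie in one rescaled copy of
   [Y]. *)
have [pq|pq] := eqVneq (sval p).1 (sval q).1; last first.
  rewrite {2}/wedge_dist (negbTE pq) -addrA.
  rewrite (le_trans (wedge_dist_le_norm _ _))// lerD2l.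
  by rewrite addrC wedge_dist_sym wedge_norm_le_dist.
have [qr|qr] := eqVneq (sval q).1 (sval r).1; last first.
  rewrite [X in _ <= _ + X]/wedge_dist (negbTE qr) addrA.
  by rewrite (le_trans (wedge_dist_le_norm _ _))// lerD2r wedge_norm_le_dist.
rewrite /wedge_dist -qr -pq !eqxx -mulrDr ler_pM2l ?scale_gt0//.
exact: metric_triangle.
Qed.

HB.instance Definition _ := @isMetric.Build R wedge wedge_dist
  wedge_distxx wedge_dist_positivity wedge_dist_sym wedge_dist_triangle.

Lemma wedge_mdistE (p q : wedge) : mdist p q = wedge_dist p q.
Proof. by []. Qed.

Lemma mdist_wedge_base (p : wedge) : mdist p wedge_base = wedge_norm p.
Proof.
rewrite wedge_mdistE /wedge_dist; case: eqP => // _.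
by rewrite [wedge_norm wedge_base]/wedge_norm/= mdistxx mulr0 addr0.
Qed.

(** Made total by sending everything off the annulus, [y0] included, to the base point. *)
Definition inj_wedge (n : nat) (y : Y) : wedge :=
  match pselect (annulus n y) with
  | left ay => exist _ (n, y) (or_intror ay)
  | right _ => wedge_base
  end.

Lemma inj_wedgeE n y (ay : annulus n y) :
  inj_wedge n y = exist _ (n, y) (or_intror ay).
Proof. by rewrite /inj_wedge; case: pselect => // ?; apply: eq_exist. Qed.

Lemma inj_wedge_base n : inj_wedge n y0 = wedge_base.
Proof.
by rewrite /inj_wedge; case: pselect => // ay; case: (annulus_base ay).
Qed.

Lemma mdist_inj_wedge n y z : annulus n y \/ y = y0 -> annulus n z \/ z = y0 ->
  mdist (inj_wedge n y) (inj_wedge n z) = a n * mdist y z.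
Proof.
move=> [ay|->] [az|->]; rewrite ?inj_wedge_base ?mdistxx ?mulr0//.
- by rewrite !inj_wedgeE wedge_mdistE /wedge_dist/= eqxx.
- by rewrite inj_wedgeE mdist_wedge_base.
- by rewrite inj_wedgeE metric_sym mdist_wedge_base /wedge_norm/= metric_sym.
Qed.

Lemma inj_wedge_norm_le n y : wedge_norm (inj_wedge n y) <= a n * mdist y y0.
Proof.
rewrite /inj_wedge; case: pselect => // _; rewrite /wedge_norm/= mdistxx mulr0.
by rewrite mulr_ge0 ?mdist_ge0// ltW// scale_gt0.
Qed.

Lemma annulus_near y : \forall n \near \oo, annulus n y \/ y = y0.
Proof.
have [->|yy0] := eqVneq y y0; first by near=> n; right.
have d0 : 0 < mdist y y0 by rewrite mdist_gt0.
near=> n; left; apply/andP; split.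
  by apply/ltW; near: n; exact: (near_infty_natSinv_lt (PosNum d0)).
rewrite (@le_trans _ _ n%:R) ?ler_nat//; apply/ltW; near: n.
exact: nbhs_infty_gtr.
Unshelve. all: by end_near. Qed.

(* Seen from scale [a n], a point off the [n]-th annulus is either almost at the
   base point or almost at infinity. *)
Lemma wedge_norm_gap n (p : wedge) : (sval p).1 <> n ->
  wedge_norm p <= a n / n.+1%:R \/ a n * n.+1%:R <= wedge_norm p.
Proof.
have a0 := scale_gt0 R; have [pb|/eqP pb] := eqVneq p wedge_base.
  move=> _; left; rewrite pb /wedge_norm/= mdistxx mulr0.
  by rewrite divr_ge0// ltW.
rewrite /wedge_norm; case: p pb => -[m y] /= [my|ay] pb.
  by case: pb; apply: eq_exist.
case/andP: ay {pb} => /= ay ya.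
move/eqP; rewrite neq_ltn => /orP[mn|nm]; [left|right].
  rewrite ler_pdivlMr// (le_trans _ (scale_growth R mn))// ler_pM2r//.
  by rewrite ler_pM2l.
rewrite (@le_trans _ _ (a m / m.+1%:R))//; last by rewrite ler_pM2l.
by rewrite ler_pdivlMr// (scale_growth R nm).
Qed.

(** The inner radius puts annulus m+1 at norm at least a_(m+1)/(m+2) >= m+1; hence a ball meets
    finitely many annuli. *)
Lemma wedge_norm_ge_index p : p <> wedge_base ->
  (sval p).1%:R <= wedge_norm p + 1.
Proof.
rewrite /wedge_norm; case: p => -[m y] /= [my|ay] pb.
  by case: pb; apply: eq_exist.
case/andP: ay {pb} => /= ay _.
case: m => [|m] in ay *.
  by rewrite addr_ge0// mulr_ge0 ?mdist_ge0// ltW// scale_gt0.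
rewrite (@le_trans _ _ (a m.+1 / m.+2%:R))//; last first.
  by rewrite (@le_trans _ _ (a m.+1 * mdist y y0)) ?lerDl// ler_pM2l ?scale_gt0.
rewrite ler_pdivlMr// (le_trans _ (scale_growth R (ltnSn m)))// ler_pM2r//.
by rewrite -[leLHS]mul1r ler_pM2r// -[1]/(1%:R) ler_nat expn_gt0 fact_gt0.
Qed.

(** An ultrafilter containing a ball either sits at the base point or concentrates on a single
    annulus, where properness of [Y] gives a limit. *)
Lemma wedge_proper : proper_metric Y -> proper_metric wedge.
Proof.
move=> Yproper; apply: (ultra_cvg_proper (e := wedge_base)) => r F F_ultra Fr.
have [Fb|Fnb] := in_ultra_setVsetC [set wedge_base] F_ultra.
  exists wedge_base => A bA; apply: filterS Fb => _ ->; exact: nbhs_singleton.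
have [k Fk] : exists k, F [set p | (sval p).1 = k].
  have [M _ /(_ M (leqnn M)) /= rM] := nbhs_infty_gtr (r + 1).
  have : F [set p | ((sval p).1 < M)%N].
    apply: filterS2 Fr Fnb => p /=; rewrite mdist_wedge_base => pr pb.
    rewrite -(ltr_nat R) (le_lt_trans (wedge_norm_ge_index pb))//.
    by rewrite (le_lt_trans _ rM)// lerD2r.
  (* Descent on [M]: an ultrafilter living on finitely many indices picks one of them. *)
  elim: M {rM} => [|M IHM] FM; first by have [] := filter_ex FM.
  have [FMM|FM'] := in_ultra_setVsetC [set p : wedge | (sval p).1 = M] F_ultra.
    by exists M.
  apply: IHM; apply: filterS2 FM FM' => p /=; rewrite ltnS leq_eqVlt.
  by case: eqP.
have Fa : F [set p | annulus k (sval p).2 /\ (sval p).1 = k].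
  apply: filterS2 Fk Fnb => -[[m y] /= [my|ay]] <- pb; last by [].
  by case: pb; apply: eq_exist.
have [|l Fl] := @proper_ultra_cvg R Y y0 k.+1%:R wedge F (fun p => (sval p).2)
    Yproper F_ultra.
  by apply: filterS Fa => p [/andP[_ +] _]; rewrite /= metric_sym.
(* Both radius bounds are non-strict, so they pass to the limit. *)
have al : annulus k l.
  apply/andP; split; apply/ler_addgt0Pl => d d0;
    have [p [/= lp [/andP[ap pa] _]]] := filter_ex (filterI (cvgr_dist_lt Fl d0) Fa).
    rewrite (le_trans ap)// (le_trans (metric_triangle _ l _))// lerD2r.
    by rewrite metric_sym ltW.
  by rewrite (le_trans (metric_triangle _ (sval p).2 _))// lerD// ltW.
exists (inj_wedge k l); apply/fcvgrPdist_lt => d d0.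
have dk : 0 < d / a k by rewrite divr_gt0// scale_gt0.
apply: filterS2 (cvgr_dist_lt Fl dk) Fa => p lp [_ pk].
rewrite inj_wedgeE wedge_mdistE /wedge_dist/= pk eqxx mulrC.
by rewrite -ltr_pdivlMr ?scale_gt0.
Qed.

End Wedge.

(** * The cone of the wedge *)

Section WedgeCone.
Context (R : realType) (Y : metricType R) (y0 : Y).
Context (mu : set_system nat) (mu_ultra : UltraFilter mu).
Context (mu_infty : mu --> \oo).
Local Notation a := (scale R).
Local Notation e := (wedge_base y0).
Local Notation cseq := (cone_seq e a mu).
Local Notation dist := (@cone_dist R (wedge y0) a mu).

Lemma inj_wedge_bounded y : cone_bounded e a mu (fun n => inj_wedge y0 n y).
Proof.
exists (mdist y y0 + 1); first by rewrite ltr_wpDl// mdist_ge0.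
near=> n; rewrite mdist_wedge_base ltr_pdivrMr ?scale_gt0// mulrC.
by rewrite (le_lt_trans (inj_wedge_norm_le _ _ _))// ltr_pM2l ?scale_gt0// ltrDl.
Unshelve. all: by end_near. Qed.

Definition cone_inj (y : Y) : cseq := exist _ _ (inj_wedge_bounded y).

(** Each point of [Y] other than [y0] lies in all annuli of large index, and [mu] tends to infinity,
    so the quotient under the limit is constant [mu]-almost everywhere. *)
Lemma cone_inj_dist y z :
  dist (cone_val (cone_inj y)) (cone_val (cone_inj z)) = mdist y z.
Proof.
apply: cvg_lim => //; apply: cvg_near_cst.
have nearY (x : Y) := mu_infty (annulus_near y0 x).
near=> n; rewrite /cone_val/= mdist_inj_wedge; last 2 first.
- by near: n; exact: nearY.
- by near: n; exact: nearY.
by rewrite mulrAC divff ?mul1r// gt_eqF ?scale_gt0.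
Unshelve. all: by end_near. Qed.

(** The part of [p] visible at scale [a n]: anything off the n-th annulus collapses to [y0]. *)
Definition wedge_comp (n : nat) (p : wedge y0) : Y :=
  if (sval p).1 == n then (sval p).2 else y0.

Lemma wedge_compP n p : annulus y0 n (wedge_comp n p) \/ wedge_comp n p = y0.
Proof.
rewrite /wedge_comp; case: eqP => [<-|_]; last by right.
by case: p => -[m y] /= [[_ ->]|]; [right|left].
Qed.

Lemma inj_wedge_comp n p :
  (sval p).1 = n -> inj_wedge y0 n (wedge_comp n p) = p.
Proof.
rewrite /wedge_comp => <-; rewrite eqxx; case: p => -[m y] /= [my|ay].
  case: (my) => _ yE; rewrite [X in inj_wedge _ _ X]yE inj_wedge_base.
  by apply: eq_exist; rewrite my.
by rewrite (inj_wedgeE ay); apply: eq_exist.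
Qed.

(** Off the n-th annulus, the bound on the norm rules out the far alternative of
    [wedge_norm_gap]. *)
Lemma mdist_wedge_comp n p : wedge_norm p < a n * n.+1%:R ->
  mdist p (inj_wedge y0 n (wedge_comp n p)) <= a n / n.+1%:R.
Proof.
move=> pn; have [pi|/eqP pi] := eqVneq (sval p).1 n.
  by rewrite inj_wedge_comp// mdistxx divr_ge0// ltW// scale_gt0.
rewrite /wedge_comp; move/eqP: (pi) => /negbTE ->.
rewrite inj_wedge_base mdist_wedge_base.
by have [//|] := wedge_norm_gap pi; rewrite leNgt pn.
Qed.

(** The point [y] is the limit along [mu] of the components [z n], which stay within [C] of [y0]
    [mu]-almost everywhere. *)
Lemma cone_inj_surj (x : cseq) : proper_metric Y ->
  exists y, dist (cone_val x) (cone_val (cone_inj y)) = 0.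
Proof.
case: x => x [C C0 xC] Yproper.
have xC' : \forall n \near mu, wedge_norm (x n) < C * a n.
  by apply: filterS xC => n; rewrite mdist_wedge_base ltr_pdivrMr// scale_gt0.
pose z n := wedge_comp n (x n).
have [|y zy] := @proper_ultra_cvg R Y y0 C nat mu z Yproper mu_ultra.
  apply: filterS xC' => n /=; rewrite /z /wedge_comp metric_sym.
  case: eqP => [xn|_ _]; last by rewrite mdistxx ltW.
  by rewrite /wedge_norm xn [C * _]mulrC ltr_pM2l ?scale_gt0// => /ltW.
exists y; apply: cvg_lim => //=.
have zy0 : mdist y (z n) @[n --> mu] --> (0 : R).
  apply/(@cvgrPdist_lt R R^o) => d d0.
  apply: filterS (cvgr_dist_lt zy d0) => n.
  by rewrite /mdist/= subr0 ger0_norm// mdist_ge0.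
(* This bounds the rescaled distance: 1/(n+1) is the cost of replacing [x n] by its component, the
   rest is the distance left between [y] and [z n]. *)
have hy0 : n.+1%:R^-1 + mdist y (z n) @[n --> mu] --> (0 : R).
  rewrite -[0]addr0; apply: cvgD zy0.
  exact: cvg_trans (cvg_app _ mu_infty) cvg_harmonic.
apply: (squeeze_cvgr _ (cvg_cst 0) hy0).
have nearY := mu_infty (annulus_near y0 y).
(* Once n > C, the norm of [x n] is below the threshold of [mdist_wedge_comp]. *)
have nearC := mu_infty (nbhs_infty_gtr C).
near=> n; rewrite /cone_val/=; apply/andP; split.
  by rewrite divr_ge0 ?mdist_ge0// ltW// scale_gt0.
rewrite ler_pdivrMr ?scale_gt0//.
rewrite (le_trans (metric_triangle _ (inj_wedge y0 n (z n)) _))//.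
rewrite mulrDl lerD//.
  rewrite mulrC mdist_wedge_comp//.
  have xn : wedge_norm (x n) < C * a n by near: n.
  rewrite (lt_trans xn)// mulrC ltr_pM2l ?scale_gt0//.
  rewrite (@lt_trans _ _ n%:R) ?ltr_nat//; near: n; exact: nearC.
rewrite mdist_inj_wedge ?[mdist y _]metric_sym 1?mulrC//.
  exact: wedge_compP.
by near: n; exact: nearY.
Unshelve. all: by end_near. Qed.

End WedgeCone.

(** * The isometry and the theorem *)

Lemma wedge_cone_isometric (R : realType) (Y : metricType R) (y0 : Y)
    (mu : set_system nat) (mu_ultra : UltraFilter mu) :
  proper_metric Y -> mu --> \oo ->
  isometric (Cone (wedge_base y0) (scale_gt0 R) mu_ultra) Y.
Proof.
move=> Yproper mu_infty; set K := Cone _ _ _.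
pose g y : K := \pi_K (cone_inj y0 mu_ultra y).
have gdist y z : mdist (g y) (g z) = mdist y z.
  by rewrite Cone_mdistE -[LHS]/(cone_dist _ _ _ _) cone_inj_dist.
(* As [g] reaches every class, choice gives a section [f]; it is onto because [g] is injective. *)
have [f fg] : {f : K -> Y & forall p, g (f p) = p}.
  apply: (@choice _ _ (fun p y => g y = p)) => p.
  have [y py] := cone_inj_surj mu_ultra mu_infty (repr p) Yproper.
  by exists y; apply: mdist_positivity; rewrite metric_sym -{1}(reprK p) Cone_mdistE.
exists f; split=> [p q|y]; first by rewrite -gdist !fg.
by exists (g y); apply: mdist_positivity; rewrite -gdist fg mdistxx.
Qed.

Theorem theorem4p1 (R : realType) (Y : metricType R) :
  [set: Y] !=set0 -> proper_metric Y ->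
  exists (X : metricType R) (e : X)
         (alpha : nat -> R) (alpha_gt0 : forall n, 0 < alpha n),
    [/\ proper_metric X,
        alpha n @[n --> \oo] --> +oo &
        forall (mu : set_system nat) (mu_ultra : UltraFilter mu),
          nonprincipal mu -> isometric (Cone e alpha_gt0 mu_ultra) Y].
Proof.
move=> [y0 _] Yproper.
exists (wedge y0 : metricType R), (wedge_base y0), (scale R), (scale_gt0 R).
split; first exact: wedge_proper.
  apply/cvgryPge => A; near=> n; apply: le_trans (scale_ge R n).
  by apply/ltW; near: n; exact: nbhs_infty_gtr.
move=> mu mu_ultra mu_np; apply: wedge_cone_isometric => //.
exact: nonprincipal_cvg_infty.
Unshelve. all: by end_near. Qed.
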